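(* Let $S_1,S_2$ be closed symmetric operators in separable Hilbert spaces $\mathfrak H_1,\mathfrak H_2$, let $\Gamma^{(j)}:\mathfrak H_j^2\to\mathcal H^2$ be boundary relations for $S_j^*$ which satisfy the conditions (B1)–(B3), let $M_j(\lambda)$ be the corresponding Weyl functions of $S_j$, $j=1,2$, and let $\mathfrak H=\mathfrak H_1\oplus\mathfrak H_2$. Then: (i) the linear relation $$H^{(3)}=\Big\{\widehat f_1\oplus\widehat f_2:\Big\{\widehat f_1,\begin{pmatrix}0\\ h_1\end{pmatrix}\Big\}\in\Gamma^{(1)},\ \Big\{\widehat f_2,\begin{pmatrix}0\\ -h_1\end{pmatrix}\Big\}\in\Gamma^{(2)}\text{ for some }h_1\in\mathcal H\Big\}$$ is closed and symmetric in $\mathfrak H$ and has equal defect numbers; (ii) the linear relation $\Gamma^{(3)}:\mathfrak H^2\to\mathcal H^2$ given by $$\Gamma^{(3)}=\Big\{\Big\{\widehat f_1\oplus\widehat f_2,\begin{pmatrix}h\\ h_1+h_2\end{pmatrix}\Big\}:\Big\{\widehat f_1,\begin{pmatrix}h\\ h_1\end{pmatrix}\Big\}\in\Gamma^{(1)},\ \Big\{\widehat f_2,\begin{pmatrix}h\\ h_2\end{pmatrix}\Big\}\in\Gamma^{(2)},\ h,h_1,h_2\in\mathcal H\Big\}$$ is a boundary relation for $(H^{(3)})^*$ which satisfies the conditions (B1)–(B3); (iii) the Weyl function $M(\lambda)$ associated to $\Gamma^{(3)}$ is $$M(\lambda)=M_1(\lambda)+M_2(\lambda),\qquad\lambda\in\mathbb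 C\setminus\mathbb R.$$
   Context: A linear relation from $\mathfrak H_1$ to $\mathfrak H_2$ is a linear subspace of $\mathfrak H_1\times\mathfrak H_2$. Write $\widehat f=\{f,f'\}$ etc.; pairs are also written as columns; for $\widehat f_j=\{f_j,f_j'\}\in\mathfrak H_j^2$, $\widehat f_1\oplus\widehat f_2=\{f_1\oplus f_2,f_1'\oplus f_2'\}\in(\mathfrak H_1\oplus\mathfrak H_2)^2$. $S^*$ is the adjoint linear relation. Boundary relation: for a closed symmetric linear relation $S$ in $\mathfrak H$, a linear relation $\Gamma:\mathfrak H^2\to\mathcal H^2$ is a boundary relation for $S^*$ if (G1) $\operatorname{dom}\Gamma$ is dense in $S^*$ and $(f',g)_{\mathfrak H}-(f,g')_{\mathfrak H}=(h',k)_{\mathcal H}-(h,k')_{\mathcal H}$ (Green's identity) for all $\{\widehat f,\widehat h\},\{\widehat g,\widehat k\}\in\Gamma$; (G2) every $\{\widehat g,\widehat k\}\in\mathfrak H^2\times\mathcal H^2$ satisfying this identity for all $\{\widehat f,\widehat h\}\in\Gamma$ belongs to $\Gamma$. Put $\Gamma_0=\{\{\widehat f,h\}:\{\widehat f,\widehat h\}\in\Gamma,\widehat h=\{h,h'\}\}$. The Weyl family is $M(\lambda)=\{\widehat h\in\mathcal H^2:\{\widehat f_\lambda,\widehat h\}\in\Gamma\text{ for some }\widehat f_\lambda=\{f,\lambda f\}\}$, $\lambda\in\mathbb C\setminus\mathbb R$. Conditions (B1)–(B3): (B1) Green's identity holds; (B2) $\operatorname{ran}\Gamma_0=\mathcal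 H$; (B3) $A_0:=\ker\Gamma_0$ is a selfadjoint linear relation in $\mathfrak H$. Under these conditions $M(\lambda)$ is a bounded everywhere defined operator in $\mathcal H$ for every $\lambda\in\mathbb C\setminus\mathbb R$ (called the Weyl function). *)

(* Defs.v *)
From HB Require Import structures.
From mathcomp Require Import all_boot all_order all_algebra.
From mathcomp Require Import sesquilinear complex.
From mathcomp Require Import all_classical all_reals all_analysis ring.

Set Implicit Arguments.
Unset Strict Implicit.
Unset Printing Implicit Defensive.

Import Order.TTheory GRing.Theory Num.Theory Num.Def.
Import numFieldNormedType.Exports.

Local Open Scope classical_set_scope.
Local Open Scope ring_scope.
Local Open Scope complex_scope.

(* The inner product is linear in its first argument and conjugate-linear in
   the second one (the convention of sesquilinear.v). *)
HB.mixin Record NormedModule_isPreHilbert (R : realType) V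
    & NormedModule R[i] V := {
  inner : {dot V for conjC} ;
  inner_norm : forall x : V, inner x x = `|x| ^+ 2
}.

#[short(type="hilbertType")]
HB.structure Definition Hilbert (R : realType) :=
  { V of CompleteNormedModule R[i] V & NormedModule_isPreHilbert R V }.

(* An alias of V * W is needed because V * W carries the max norm. *)
Definition hsum (V W : Type) : Type := (V * W)%type.

Section HilbertSum.
Variables (R : realType) (V W : hilbertType R).
Local Notation C := R[i].
Local Notation VW := (hsum V W).

HB.instance Definition _ := GRing.Lmodule.copy VW (V * W)%type.

Definition hsum_inner (x y : VW) : C :=
  inner x.1 y.1 + inner x.2 y.2.

Lemma hsum_inner_bilinear : bilinear_for
  ( *%R : GRing.Scale.law _ _) (conjC \; *%R : GRing.Scale.law _ _)
  hsum_inner.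
Proof.
split=> z a x y; rewrite /hsum_inner /=.
  by rewrite !linearPl /= mulrDr addrACA.
by rewrite !linearPr /= mulrDr addrACA.
Qed.

HB.instance Definition _ := bilinear_isBilinear.Build C VW VW C
  ( *%R : GRing.Scale.law _ _) (conjC \; *%R : GRing.Scale.law _ _)
  hsum_inner hsum_inner_bilinear.

Lemma hsum_inner_hermitian x y :
  hsum_inner x y = (-1) ^+ false * conjC (hsum_inner y x).
Proof.
rewrite /hsum_inner expr0 mul1r rmorphD /=.
by congr (_ + _); rewrite [LHS]hermC expr0 mul1r.
Qed.

HB.instance Definition _ := isHermitianSesquilinear.Build C VW false conjC
  hsum_inner hsum_inner_hermitian.

Lemma hsum_innerE x : hsum_inner x x = `|x.1| ^+ 2 + `|x.2| ^+ 2.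
Proof. by rewrite /hsum_inner !inner_norm. Qed.

Lemma hsum_inner_gt0 x : x != 0 -> 0 < hsum_inner x x.
Proof.
move=> x0; rewrite hsum_innerE lt_def addr_ge0 ?sqr_ge0 ?exprn_ge0// andbT.
apply: contra x0; rewrite paddr_eq0 ?exprn_ge0// !sqrf_eq0 !normr_eq0.
by case: x => a b /= /andP[/eqP-> /eqP->].
Qed.

HB.instance Definition _ := isDotProduct.Build C VW hsum_inner hsum_inner_gt0.

Definition hsum_norm (x : VW) : C := sqrtC (hsum_inner x x).

Lemma hsum_norm_ge0 x : 0 <= hsum_norm x.
Proof. by rewrite sqrtC_ge0 hsum_innerE addr_ge0 ?exprn_ge0. Qed.

Lemma hsum_normZ (a : C) x : hsum_norm (a *: x) = `|a| * hsum_norm x.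
Proof.
rewrite /hsum_norm !hsum_innerE /= !normrZ !exprMn -mulrDr.
by rewrite rootCMl ?exprn_ge0// sqrCK.
Qed.

Lemma hsum_normr0_eq0 x : hsum_norm x = 0 -> x = 0.
Proof.
move=> /eqP; rewrite sqrtC_eq0 => x0; apply: contraTeq x0 => /hsum_inner_gt0.
by rewrite lt_def => /andP[].
Qed.

Lemma hsum_ler_normD x y : hsum_norm (x + y) <= hsum_norm x + hsum_norm y.
Proof.
have sq_ge0 z : 0 <= hsum_inner z z.
  by rewrite hsum_innerE addr_ge0 ?exprn_ge0.
have ge0D : 0 <= hsum_norm x + hsum_norm y by rewrite addr_ge0 ?hsum_norm_ge0.
rewrite -(@ler_pXn2r _ 2)// ?nnegrE ?hsum_norm_ge0// sqrrD !sqrtCK.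
have CS : `|x.1| * `|y.1| + `|x.2| * `|y.2| <= hsum_norm x * hsum_norm y.
  rewrite -(@ler_pXn2r _ 2)// ?nnegrE ?addr_ge0 ?mulr_ge0 ?hsum_norm_ge0//.
  rewrite exprMn !sqrtCK !hsum_innerE -subr_ge0.
  rewrite [X in 0 <= X](_ : _ = (`|x.1| * `|y.2| - `|x.2| * `|y.1|) ^+ 2).
    by rewrite real_exprn_even_ge0// rpredB// ger0_real// mulr_ge0.
  by ring.
apply: (@le_trans _ _ ((`|x.1| + `|y.1|) ^+ 2 + (`|x.2| + `|y.2|) ^+ 2)).
  by rewrite hsum_innerE lerD// lerXn2r ?nnegrE ?addr_ge0// ler_normD.
rewrite !hsum_innerE [leRHS](_ : _ = `|x.1| ^+ 2 + `|y.1| ^+ 2 +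
  (`|x.2| ^+ 2 + `|y.2| ^+ 2) + hsum_norm x * hsum_norm y *+ 2); last by ring.
rewrite [leLHS](_ : _ = `|x.1| ^+ 2 + `|y.1| ^+ 2 +
  (`|x.2| ^+ 2 + `|y.2| ^+ 2) + (`|x.1| * `|y.1| + `|x.2| * `|y.2|) *+ 2).
  by rewrite lerD2l lerMn2r.
by ring.
Qed.

HB.instance Definition _ := Lmodule_isNormed.Build C VW
  hsum_ler_normD hsum_normZ hsum_normr0_eq0.

Lemma hsum_normE (x : VW) : `|x| = sqrtC (inner x.1 x.1 + inner x.2 x.2).
Proof. by []. Qed.

Lemma hsum_ler_norm1 (x : VW) : `|x.1| <= `|x|.
Proof.
rewrite -(@ler_pXn2r _ 2)// ?nnegrE// sqrtCK hsum_innerE.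
by rewrite lerDl exprn_ge0.
Qed.

Lemma hsum_ler_norm2 (x : VW) : `|x.2| <= `|x|.
Proof.
rewrite -(@ler_pXn2r _ 2)// ?nnegrE// sqrtCK hsum_innerE.
by rewrite lerDr exprn_ge0.
Qed.

Lemma hsum_ler_normD12 (x : VW) : `|x| <= `|x.1| + `|x.2|.
Proof.
rewrite -(@ler_pXn2r _ 2)// ?nnegrE ?addr_ge0// sqrtCK hsum_innerE sqrrD.
by rewrite addrAC lerDl mulrn_wge0// mulr_ge0.
Qed.

Lemma hsum_complete (F : set_system VW) :
  ProperFilter F -> cauchy F -> cvg F.
Proof.
move=> PF /cauchy_ballP Fc.
have F1 : cvg ((fun x : VW => x.1) @ F).
  apply: cauchy_cvg; apply/cauchy_ballP => e e0.
  have [[A B] [/= FA FB] AB] := Fc _ e0.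
  exists ((fun x : VW => x.1) @` A, (fun x : VW => x.1) @` B).
    by split; [apply: filterS FA|apply: filterS FB] => x Ax /=; exists x.
  move=> [_ _] [/= [x Ax <-] [y By <-]].
  have := AB (x, y) (conj Ax By); rewrite -!ball_normE /ball_/= => xy.
  exact: le_lt_trans (hsum_ler_norm1 (x - y)) xy.
have F2 : cvg ((fun x : VW => x.2) @ F).
  apply: cauchy_cvg; apply/cauchy_ballP => e e0.
  have [[A B] [/= FA FB] AB] := Fc _ e0.
  exists ((fun x : VW => x.2) @` A, (fun x : VW => x.2) @` B).
    by split; [apply: filterS FA|apply: filterS FB] => x Ax /=; exists x.
  move=> [_ _] [/= [x Ax <-] [y By <-]].
  have := AB (x, y) (conj Ax By); rewrite -!ball_normE /ball_/= => xy.
  exact: le_lt_trans (hsum_ler_norm2 (x - y)) xy.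
move: F1 F2 => /cvg_ex[/= a Fa] /cvg_ex[/= b Fb].
apply/cvg_ex; exists ((a, b) : VW).
apply/cvgrPdist_lt => e e0; near=> x.
apply: le_lt_trans (hsum_ler_normD12 _) _.
rewrite (splitr e) ltrD//=; near: x.
  by move/cvgrPdist_lt: Fa; apply; rewrite divr_gt0.
by move/cvgrPdist_lt: Fb; apply; rewrite divr_gt0.
Unshelve. all: by end_near. Qed.

HB.instance Definition _ := Uniform_isComplete.Build VW hsum_complete.

Lemma hsum_inner_norm (x : VW) : hsum_inner x x = `|x| ^+ 2.
Proof. by rewrite sqrtCK. Qed.

HB.instance Definition _ := NormedModule_isPreHilbert.Build R VW hsum_inner_norm.

Lemma hsum_innerP (x y : VW) : inner x y = inner x.1 y.1 + inner x.2 y.2.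
Proof. by []. Qed.

End HilbertSum.

Section HilbertSpaces.
Variable R : realType.
Local Notation C := R[i].

Definition separable (T : topologicalType) :=
  exists D : set T, countable D /\ dense D.

Definition is_subspace (E : lmodType C) (S : set E) :=
  S 0 /\ forall (a : C) (u v : E), S u -> S v -> S (a *: u + v).

Definition orthonormal_basis (H : hilbertType R) (N E : set H) :=
  [/\ E `<=` N,
      forall e, E e -> inner e e = 1,
      forall e e', E e -> E e' -> e <> e' -> inner e e' = 0 &
      forall x, N x -> (forall e, E e -> inner x e = 0) -> x = 0].

(* Equality of the Hilbert dimensions of two closed subspaces. *)
Definition same_hilbert_dim (H H' : hilbertType R) (N : set H) (N' : set H') :=
  exists E E', [/\ orthonormal_basis N E, orthonormal_basis N' E' & (E #= E')%card].

End HilbertSpaces.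

Section LinearRelations.
Variable R : realType.
Local Notation C := R[i].

(* A pair {f, g} is (f, g), and a relation is identified with its graph. The
   max norm of the library on V * W is equivalent to the Hilbert norm, so that
   closed and closure have their usual meaning for relations. *)

Definition rel_dom (V W : Type) (G : set (V * W)) : set V := fst @` G.

Definition rel_ran (V W : Type) (G : set (V * W)) : set W := snd @` G.

Definition rel_ker (V : Type) (W : lmodType C) (G : set (V * W)) : set V :=
  [set f | G (f, 0)].

Definition graph (V W : Type) (T : V -> W) : set (V * W) :=
  [set p | p.2 = T p.1].

Definition is_operator (V W : Type) (S : set (V * W)) :=
  forall f g g', S (f, g) -> S (f, g') -> g = g'.

Variable H : hilbertType R.
Implicit Types S : set (H * H).

Definition adjoint S : set (H * H) :=
  [set g | forall f, S f -> inner f.2 g.1 = inner f.1 g.2].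

Definition symmetric_relation S := S `<=` adjoint S.

Definition selfadjoint S := S = adjoint S.

Definition closed_symmetric_relation S :=
  [/\ is_subspace S, closed S & symmetric_relation S].

Definition defect_space S (l : C) : set H :=
  [set f | adjoint S (f, l *: f)].

(* n_+(S) = n_-(S), where n_+(S) = dim ker (S^* - l) and
   n_-(S) = dim ker (S^* - conj l) do not depend on the choice of l in the
   upper half-plane; the equality is required at every such l. *)
Definition equal_defect_numbers S :=
  forall l : C, 0 < 'Im l ->
    same_hilbert_dim (defect_space S l) (defect_space S (conjC l)).

End LinearRelations.

Section BoundaryRelations.
Variables (R : realType) (H K : hilbertType R).
Local Notation C := R[i].
Implicit Types G : set ((H * H) * (K * K)).

Definition green_identity (p q : (H * H) * (K * K)) :=
  inner p.1.2 q.1.1 - inner p.1.1 q.1.2 = inner p.2.2 q.2.1 - inner p.2.1 q.2.2.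

Definition green G := forall p q, G p -> G q -> green_identity p q.

(* T stands for S^*. *)
Definition boundary_relation (T : set (H * H)) G :=
  [/\ is_subspace G,
      rel_dom G `<=` T /\ T `<=` closure (rel_dom G),
      green G &
      forall q, (forall p, G p -> green_identity p q) -> G q].

Definition Gamma0 G : set ((H * H) * K) :=
  [set p | exists h', G (p.1, (p.2, h'))].

Definition B1 G := green G.

Definition B2 G := rel_ran (Gamma0 G) = setT.

Definition B3 G := selfadjoint (rel_ker (Gamma0 G)).

Definition weyl_family G (l : C) : set (K * K) :=
  [set h | exists f, G ((f, l *: f), h)].

(* The operator M(l) whose graph is weyl_family G l; the value of get is
   meaningful only where the Weyl family is such a graph, which B1, B2 and B3
   ensure for every nonreal l. *)
Definition weyl_function G (l : C) : K -> K :=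
  fun h => get [set h' | weyl_family G l (h, h')].

End BoundaryRelations.

Section Coupling.
Variables (R : realType) (H1 H2 K : hilbertType R).
Local Notation H12 := (hsum H1 H2).
Variables (G1 : set ((H1 * H1) * (K * K))) (G2 : set ((H2 * H2) * (K * K))).

Definition osum (f1 : H1 * H1) (f2 : H2 * H2) : H12 * H12 :=
  ((f1.1, f2.1), (f1.2, f2.2)).

Definition H3 : set (H12 * H12) :=
  [set f | exists f1 f2 h1,
    [/\ f = osum f1 f2, G1 (f1, (0, h1)) & G2 (f2, (0, - h1))]].

Definition Gamma3 : set ((H12 * H12) * (K * K)) :=
  [set p | exists f1 f2 h h1 h2,
    [/\ p = (osum f1 f2, (h, h1 + h2)), G1 (f1, (h, h1)) & G2 (f2, (h, h2))]].

End Coupling.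

(* Main.v *)
Require Import Defs.
From mathcomp Require Import all_boot all_order all_algebra.
From mathcomp Require Import sesquilinear complex.
From mathcomp Require Import all_classical all_reals all_analysis.
From mathcomp Require Import ring.

(** Everything follows from one observation: for a linear relation [G], the
Green identity together with [B2] and [B3] already forces [G] to be a boundary
relation, for the adjoint of its kernel ([boundary_relation_of_B]).  Those
conditions pass to the coupling because [Gamma3] is built componentwise from
[G1] and [G2] over a common first boundary value.  Its Green identity is the
sum of the two given ones, a prescribed first boundary value is attained by
attaining it in both components, and the kernel of its [Gamma0] is the
orthogonal sum of two selfadjoint relations.

Maximality of such a [G]: subtracting from a pair that satisfies the Green
identity against [G] first an element of [G] with the same first boundary
value (by [B2]), then an element over the kernel of [Gamma0] (by [B3]), leaves
a pair [(0, (0, m))], and [m] is orthogonal to the range of [Gamma0], that is,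
to the whole space.  Maximality identifies [rel_ker G] with the adjoint of
[rel_dom G]; hence this kernel is closed, and the density of [rel_dom G] in
the adjoint of [rel_ker G] says that a double adjoint is contained in the
closure.

The latter, and all the spectral theory that is used, rest on the orthogonal
projection theorem ([projection]), applied in [H (+) H] to the graph of a
relation ([graph_decomposition]).  For a selfadjoint [A] the decomposition
reads off a solution of [f' - i f = v] in [A], and replacing [A] by
[(A - Re l) / Im l] gives [ran (A - l) = H] for every nonreal [l].  This
range condition has two uses.  It makes the Weyl family total, and the absence
of nonreal eigenvalues makes it single valued, whence the additivity of the
Weyl functions.  It also makes the Cayley transform of [A], which preserves
inner products, a bijection between the two defect spaces of any [S] contained
in [A]; as it carries orthonormal bases to orthonormal bases, a relation with
a selfadjoint extension has equal defect numbers.  For [H3], which is the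
kernel of [Gamma3] ([H3_rel_ker]), the extension is the kernel of [Gamma0] of
[Gamma3]. *)

Import Order.TTheory GRing.Theory Num.Theory Num.Def.
Import numFieldNormedType.Exports.

Local Open Scope classical_set_scope.
Local Open Scope ring_scope.
Local Open Scope complex_scope.

Set Implicit Arguments.
Unset Strict Implicit.
Unset Printing Implicit Defensive.

(** * Inner products and orthogonal projection *)

Lemma subspaceB (R : realType) (V : lmodType R[i]) (N : set V) (x y : V) :
  is_subspace N -> N x -> N y -> N (x - y).
Proof.
by move=> [_ NP] Nx Ny; have := NP (-1) _ _ Ny Nx; rewrite scaleN1r addrC.
Qed.

Section Inner.
Variables (R : realType) (E : hilbertType R).
Local Notation C := R[i].
Implicit Types (x y z : E) (a : C).

Lemma innerDl x y z : inner (x + y) z = inner x z + inner y z.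
Proof. exact: linearDl. Qed.
Lemma innerDr x y z : inner z (x + y) = inner z x + inner z y.
Proof. exact: linearDr. Qed.
Lemma innerBl x y z : inner (x - y) z = inner x z - inner y z.
Proof. exact: linearBl. Qed.
Lemma innerBr x y z : inner z (x - y) = inner z x - inner z y.
Proof. exact: linearBr. Qed.
Lemma innerZl a x z : inner (a *: x) z = a * inner x z.
Proof. exact: linearZl_LR. Qed.
Lemma innerZr a x z : inner z (a *: x) = conjC a * inner z x.
Proof. exact: linearZr_LR. Qed.
Lemma inner0l z : inner 0 z = 0.
Proof. exact: linear0l. Qed.
Lemma inner0r z : inner z 0 = 0.
Proof. exact: linear0r. Qed.
Lemma innerC x y : inner x y = conjC (inner y x).
Proof. by rewrite hermC expr0 mul1r. Qed.

Lemma inner_eq0 x : inner x x = 0 -> x = 0.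
Proof. by move=> /eqP; rewrite dnorm_eq0 => /eqP. Qed.

(** Minimising the right-hand side over [a] gives [a = (w, z) / (z, z)], where
it equals [`|w| ^+ 2 - `|(w, z)| ^+ 2 / `|z| ^+ 2 + e ^+ 2].  With [e = `|w|]
the hypothesis is void, which is the Cauchy-Schwarz inequality; with small [e]
it says that a nearly shortest vector is nearly orthogonal to the directions
in which it can be moved. *)
Lemma inner_le_of_min w z (e : C) : 0 <= e ->
  (forall a, `|w| ^+ 2 <= `|w - a *: z| ^+ 2 + e ^+ 2) ->
  `|inner w z| <= e * `|z|.
Proof.
move=> e0 min; have [->|z0] := eqVneq z 0; first by rewrite inner0r !normr0 mulr0.
have zz0 : 0 < inner z z by rewrite dnorm_gt0.
rewrite -(@ler_pXn2r _ 2)// ?nnegrE ?mulr_ge0// exprMn -inner_norm normCK.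
have := min (inner w z / inner z z); rewrite -!inner_norm.
rewrite innerBl !innerBr !innerZl !innerZr (innerC z w) fmorph_div/=.
rewrite -(innerC z z) -ler_pdivrMr// -subr_ge0 => h; rewrite -subr_ge0.
apply: (le_trans h); rewrite le_eqVlt; apply/orP; left; apply/eqP.
by field; exact: lt0r_neq0.
Qed.

Lemma inner_le_norm w z : `|inner w z| <= `|w| * `|z|.
Proof. by apply: inner_le_of_min => // a; rewrite lerDr exprn_ge0. Qed.

Lemma almost_nearest (N : set E) x (e : C) : N !=set0 -> 0 < e ->
  exists2 n, N n & forall m, N m -> `|x - n| ^+ 2 <= `|x - m| ^+ 2 + e.
Proof.
move=> [n0 Nn0] e0.
(* The norm is complex valued, the infimum has to be taken in R. *)
pose D := [set complex.Re (`|x - n| ^+ 2) | n in N].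
have normE m : (complex.Re (`|x - m| ^+ 2))%:C = `|x - m| ^+ 2.
  by apply: RRe_real; rewrite ger0_real ?exprn_ge0.
have eE : (complex.Re e)%:C = e by rewrite RRe_real ?gtr0_real.
have [||_ [n Nn <-] nD] := @inf_adherent _ D (complex.Re e).
- by rewrite -ltcR eE.
- split; first by exists (complex.Re (`|x - n0| ^+ 2)), n0.
  by exists 0 => _ [m _ <-]; rewrite -lecR normE exprn_ge0.
exists n => // m Nm.
rewrite -normE -[`|x - m| ^+ 2]normE -eE -rmorphD/= lecR.
apply: (le_trans (ltW nD)); rewrite lerD2r; apply: ge_inf; last by exists m.
by exists 0 => _ [k _ <-]; rewrite -lecR normE exprn_ge0.
Qed.

(** A subspace contains points almost nearest to [x] up to any squared error;
moving such a point inside the subspace cannot shorten its distance to [x] by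
much, so the difference is almost orthogonal to the subspace. *)
Lemma almost_orthogonal (N : set E) x (e : C) : is_subspace N -> 0 < e ->
  exists2 n, N n & forall z, N z -> `|inner (x - n) z| <= e * `|z|.
Proof.
move=> Nsub e0; have [|n Nn nmin] := @almost_nearest N x _ _ (exprn_gt0 2 e0).
  by exists 0; exact: Nsub.1.
exists n => // z Nz; apply: inner_le_of_min; first exact: ltW.
move=> a; rewrite -addrA -opprD [n + _]addrC.
by rewrite nmin//; exact: Nsub.2.
Qed.

(** Two almost orthogonal approximations [n], [m] of [x] in [N] are close to
each other, since [n - m] is both in [N] and a difference of two vectors almost
orthogonal to [N].  They thus generate a Cauchy filter.  As [y] is only claimed
to lie in the closure, [N] may be any subspace. *)
Lemma projection (N : set E) x : is_subspace N ->
  exists y, closure N y /\ forall z, N z -> inner (x - y) z = 0.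
Proof.
move=> Nsub.
pose B (e : C) := [set n | N n /\ forall z, N z -> `|inner (x - n) z| <= e * `|z|].
have B0 e : 0 < e -> B e !=set0.
  by move=> e0; have [n ? ?] := almost_orthogonal x Nsub e0; exists n.
have Bdist e e' n m : 0 < e -> 0 < e' -> B e n -> B e' m -> `|n - m| <= e + e'.
  move=> e0 e'0 [Nn hn] [Nm hm]; have Nnm := subspaceB Nsub Nn Nm.
  have [->|nm0] := eqVneq (n - m) 0; first by rewrite normr0 addr_ge0// ltW.
  rewrite -(@ler_pM2r _ `|n - m|) ?normr_gt0// -expr2 -inner_norm.
  rewrite [X in inner X _](_ : _ = (x - m) - (x - n)); last first.
    by rewrite opprB [RHS]addrC subrKA.
  rewrite -[leLHS]ger0_norm; last first.
    by rewrite -[X in inner X _](_ : n - m = _) ?dnorm_ge0// opprB [RHS]addrC subrKA.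
  rewrite innerBl (le_trans (ler_normB _ _))// mulrDl addrC lerD//; [exact: hn|exact: hm].
(* The sets B e shrink with e, so they form a filter base. *)
pose F := filter_from [set e : C | 0 < e] B.
have PF : ProperFilter F.
  apply: filter_from_proper => //; apply: filter_from_filter.
    by exists 1; rewrite /= ltr01.
  move=> i j i0 j0; exists (Num.min i j); rewrite /=.
    by rewrite /Num.min; case: ifP.
  have ler_min : Num.min i j <= i /\ Num.min i j <= j.
    have := real_leVge (gtr0_real i0) (gtr0_real j0).
    rewrite /Num.min; case: (boolP (i < j)) => [/ltW ij|]; first by split.
    rewrite -real_leNgt ?gtr0_real//.
  by move=> n [Nn hn]; split; split=> // z Nz; apply: (le_trans (hn z Nz));
    rewrite ler_wpM2r//; apply ler_min.
have Fc : cauchy F.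
  apply/cauchy_ballP => e e0; have e4 : 0 < e / 4 by rewrite divr_gt0.
  exists (B (e / 4), B (e / 4)); first by split; exists (e / 4).
  move=> [n m] /= [Bn Bm]; rewrite -ball_normE /ball_/=.
  apply: (le_lt_trans (Bdist _ _ _ _ e4 e4 Bn Bm)).
  rewrite -subr_gt0 (_ : _ - _ = e / 2) ?divr_gt0//; by field.
have /cvg_ex[/= y Fy] := @cauchy_cvg E F PF Fc.
have near_y e : 0 < e -> exists2 n, B e n & `|y - n| < e.
  move=> e0; have [d d0 dP] := Fy _ (nbhsx_ballx y e e0).
  have [n [Bn Bn']] : exists n, B e n /\ B d n.
    have : F (B e `&` B d).
      by apply: filterI; [exists e|exists d].
    by move=> /filter_ex[n [? ?]]; exists n.
  by exists n => //; have := dP n Bn'; rewrite -ball_normE.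
exists y; split.
  move=> U /nbhs_ballP[e /= e0 eU]; have [n [Nn _] yn] := near_y _ e0.
  by exists n; split=> //; apply: eU; rewrite -ball_normE.
move=> z Nz; apply/eqP; rewrite -normr_eq0; apply/eqP/le_anti.
rewrite normr_ge0 andbT; apply/ler_addgt0Pl => e e0; rewrite addr0.
have z1 : 0 < `|z| + 1 by rewrite ltr_wpDl.
have d0 : 0 < e / (2 * (`|z| + 1)) by rewrite divr_gt0// mulr_gt0.
have [n [_ /(_ _ Nz) hn] yn] := near_y _ d0.
rewrite [x - y](_ : _ = (x - n) - (y - n)); last by rewrite opprB subrKA.
rewrite innerBl (le_trans (ler_normB _ _))//.
have : `|inner (y - n) z| <= e / (2 * (`|z| + 1)) * `|z|.
  by apply: (le_trans (inner_le_norm _ _)); rewrite ler_wpM2r// ltW.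
move=> /(lerD hn) /le_trans; apply.
rewrite [leRHS](_ : _ = e / (2 * (`|z| + 1)) * (`|z| + 1) +
  e / (2 * (`|z| + 1)) * (`|z| + 1)); last by field; exact: lt0r_neq0.
by rewrite lerD// ler_wpM2l ?ltW// ltrDl.
Qed.
End Inner.

(** * Adjoints of linear relations *)

Section Relations.
Variables (R : realType) (H : hilbertType R).
Local Notation C := R[i].
Implicit Types (S D A : set (H * H)).

Lemma adjoint_subspace S : is_subspace (adjoint S).
Proof.
split=> [f _|a u v Su Sv f Sf] /=; first by rewrite !inner0r.
by rewrite !innerDr !innerZr Su// Sv.
Qed.

Lemma sub_biadjoint S : S `<=` adjoint (adjoint S).
Proof.
move=> f Sf g gS; rewrite innerC (innerC g.1); apply/esym.
by congr (conjC _); exact: gS.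
Qed.

Lemma adjoint_anti S D : S `<=` D -> adjoint D `<=` adjoint S.
Proof. by move=> SD g Dg f /SD /Dg. Qed.

Lemma closure_approx (T : hilbertType R) (N : set T) x (e : C) :
  closure N x -> 0 < e -> exists2 n, N n & `|x - n| < e.
Proof.
move=> Nx e0; have [n [Nn xn]] := Nx _ (nbhsx_ballx x e e0).
by exists n => //; move: xn; rewrite -ball_normE.
Qed.

(** Each defining equation of the adjoint is continuous in [g]. *)
Lemma adjoint_closed S : closed (adjoint S).
Proof.
move=> g cl f Sf.
have approx (e : C) : 0 < e ->
    exists2 u, adjoint S u & `|g.1 - u.1| < e /\ `|g.2 - u.2| < e.
  move=> e0; have [u [Su [gu1 gu2]]] := cl _ (nbhsx_ballx g e e0).
  by exists u => //; move: gu1 gu2; rewrite -!ball_normE.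
apply/eqP; rewrite -subr_eq0 -normr_eq0; apply/eqP/le_anti.
rewrite normr_ge0 andbT; apply/ler_addgt0Pl => e e0; rewrite addr0.
have M0 : 0 < `|f.2| + `|f.1| + 1 by rewrite ltr_wpDl// addr_ge0.
have [|u Su [u1 u2]] := approx (e / (`|f.2| + `|f.1| + 1)); first exact: divr_gt0.
rewrite (_ : _ - _ = inner f.2 (g.1 - u.1) - inner f.1 (g.2 - u.2)); last first.
  by rewrite !innerBr (Su f Sf); ring.
rewrite (le_trans (ler_normB _ _))//.
have h1 := le_trans (inner_le_norm f.2 _) (ler_wpM2l (normr_ge0 f.2) (ltW u1)).
have h2 := le_trans (inner_le_norm f.1 _) (ler_wpM2l (normr_ge0 f.1) (ltW u2)).
apply: (le_trans (lerD h1 h2)); rewrite -mulrDl mulrCA ler_piMr ?ltW//.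
by rewrite ltr_pdivrMr// mul1r ltrDl.
Qed.

(** The orthogonal decomposition of [(u, v)] along [D] in the Hilbert sum
[H (+) H]: the orthogonal complement of [D] consists of the pairs
[(b.2, - b.1)] with [b] in the adjoint of [D]. *)
Lemma graph_decomposition D u v : is_subspace D ->
  exists a b, [/\ closure D a, adjoint D b, u = a.1 + b.2 & v = a.2 - b.1].
Proof.
move=> Dsub; pose N : set (hsum H H) := D.
have [a [Na orth]] := @projection R (hsum H H) N (u, v) Dsub.
exists a, (a.2 - v, u - a.1); split.
- move=> U /nbhs_ballP[e /= e0 eU]; have [n Nn an] := closure_approx Na e0.
  exists n; split=> //; apply: eU; split; rewrite -ball_normE /ball_/=.
    exact: le_lt_trans (hsum_ler_norm1 (a - n)) an.
  exact: le_lt_trans (hsum_ler_norm2 (a - n)) an.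
- move=> f Df /=; have := orth f Df; rewrite hsum_innerP/=.
  move=> /(congr1 conjC); rewrite rmorph0 rmorphD/= -!innerC => /eqP.
  rewrite addrC addr_eq0 => /eqP h.
  by rewrite -opprB -scaleN1r innerZr rmorphN1 mulN1r h opprK.
- by rewrite addrC subrK.
- by rewrite /= opprB addrC subrK.
Qed.

(** The component of an element of the double adjoint along the complement of
[D] is in the double adjoint too; pairing it with the element [b] of the adjoint
from which it comes gives [(b.2, b.2) = - (b.1, b.1)], so it vanishes. *)
Lemma biadjoint_sub_closure D : is_subspace D -> adjoint (adjoint D) `<=` closure D.
Proof.
move=> Dsub [u v] DDuv; have [a [b [Da Db uE vE]]] := graph_decomposition u v Dsub.
have DDa : adjoint (adjoint D) a.
  by apply: adjoint_closed; apply: closure_subset Da; exact: sub_biadjoint.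
have := subspaceB (adjoint_subspace _) DDuv DDa => /(_ b Db)/=.
(* What remains of (u, v) - a is (b.2, - b.1). *)
rewrite uE vE addrAC subrr add0r addrAC subrr add0r -[in RHS]scaleN1r innerZr.
rewrite rmorphN1 mulN1r => /eqP; rewrite -addr_eq0 paddr_eq0 ?dnorm_ge0//.
rewrite !dnorm_eq0 => /andP[/eqP b2 /eqP b1].
by rewrite b1 b2 subr0 addr0; case: (a) Da.
Qed.

End Relations.

(** * Selfadjoint relations and defect numbers *)

Section Selfadjoint.
Variables (R : realType) (H : hilbertType R).
Local Notation C := R[i].
Implicit Types (S A : set (H * H)) (N : set H) (l : C).

Lemma symmetric_eigen0 A l f : symmetric_relation A -> l \isn't Num.real ->
  A (f, l *: f) -> f = 0.
Proof.
move=> Asym lR Af; apply: inner_eq0; apply/eqP.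
have /eqP := Asym _ Af _ Af; rewrite /= innerZl innerZr -subr_eq0 -mulrBl mulf_eq0.
by rewrite subr_eq0 eq_sym -CrealE (negbTE lR).
Qed.

Lemma selfadjoint_closed A : selfadjoint A -> closed A.
Proof. by move=> ->; exact: adjoint_closed. Qed.

Lemma selfadjoint_subspace A : selfadjoint A -> is_subspace A.
Proof. by move=> ->; exact: adjoint_subspace. Qed.

(** Decompose [(0, v)] along [A] as [(a.1 + b.2, a.2 - b.1)] with [a] and [b]
both in [A]; then [f = a - 'i b] satisfies
[f.2 - 'i f.1 = (a.2 - b.1) - 'i (a.1 + b.2) = v]. *)
Lemma selfadjoint_ran_i A v : selfadjoint A ->
  exists2 f, A f & f.2 - 'i *: f.1 = v.
Proof.
move=> Asa; have Asub := selfadjoint_subspace Asa.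
have [a [b [Aa Ab uE vE]]] := graph_decomposition 0 v Asub.
have {}Aa := selfadjoint_closed Asa Aa; rewrite -Asa in Ab.
exists (- 'i *: b + a); first exact: Asub.2.
have a1 : a.1 = - b.2 by apply/eqP; rewrite -addr_eq0 -uE.
rewrite vE /= a1 scalerDr scalerA mulrN -expr2 sqrCi opprK scale1r.
by rewrite opprD scalerN opprK scaleNr [- b.1 + _]addrC addrACA addNr add0r.
Qed.

(** This relation is [(A - a) / b]. *)
Lemma selfadjoint_affine A (a b : C) : selfadjoint A -> a \is Num.real ->
  b \is Num.real -> b != 0 ->
  selfadjoint [set p | A (p.1, b *: p.2 + a *: p.1)].
Proof.
move=> Asa aR bR b0; rewrite /selfadjoint; apply/seteqP; split=> [p Ap q Aq|p Tp].
  have : inner (b *: q.2 + a *: q.1) p.1 = inner q.1 (b *: p.2 + a *: p.1).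
    by have := Ap; rewrite Asa => /(_ _ Aq).
  rewrite innerDl innerDr !innerZl !innerZr !conj_Creal//.
  by move=> /addIr /(mulfI b0).
rewrite /= Asa => f Af /=.
have := Tp (f.1, b^-1 *: (f.2 - a *: f.1)); rewrite /= scalerA mulfV// scale1r subrK.
case: f Af => f f' Af /(_ Af)/=.
rewrite innerZl innerBl innerDr innerZl !innerZr !conj_Creal// => <-.
by field.
Qed.

(** For [l = a + 'i b], solving for [(A - a) / b] and ['i] is solving for [A]
and [l]. *)
Lemma selfadjoint_ran A l v : selfadjoint A -> l \isn't Num.real ->
  exists2 f, A f & f.2 - l *: f.1 = v.
Proof.
move=> Asa lR; have b0 : 'Im l != 0.
  by apply: contra lR => /eqP l0; rewrite CrealE [l]Crect l0 mulr0 addr0 conj_Creal.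
have Tsa := selfadjoint_affine Asa (Creal_Re l) (Creal_Im l) b0.
have [f Tf fE] := selfadjoint_ran_i (('Im l)^-1 *: v) Tsa.
exists (f.1, 'Im l *: f.2 + 'Re l *: f.1) => //=.
have -> : v = 'Im l *: (f.2 - 'i *: f.1) by rewrite fE scalerA mulfV// scale1r.
rewrite {3}[l]Crect scalerDl opprD addrA addrK scalerBr scalerA.
by rewrite ['i * _]mulrC.
Qed.

(** Only [l + conjC l] and [l * conjC l] occur when the left-hand side is
expanded by means of the symmetry of [A]: the Cayley transform
[f.2 - conjC l *: f.1 |-> f.2 - l *: f.1] preserves inner products. *)
Lemma cayley_inner A l f g : symmetric_relation A -> A f -> A g ->
  inner (f.2 - l *: f.1) (g.2 - l *: g.1) =
  inner (f.2 - conjC l *: f.1) (g.2 - conjC l *: g.1).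
Proof.
move=> Asym Af Ag; have fg := Asym _ Ag _ Af.
rewrite !innerBl !innerBr !innerZl !innerZr fg conjCK; ring.
Qed.

(** The defect space is the orthogonal complement of [ran (S - conjC l)]. *)
Lemma defect_spaceP S l y :
  defect_space S l y <-> forall g, S g -> inner (g.2 - conjC l *: g.1) y = 0.
Proof.
split=> [yS g Sg|h g Sg] /=.
  by rewrite innerBl innerZl (yS g Sg) /= innerZr subrr.
by apply/eqP; rewrite innerZr -innerZl -subr_eq0 -innerBl h.
Qed.

Lemma defect_subspace S l : is_subspace (defect_space S l).
Proof.
have [S0 SP] := adjoint_subspace S; split=> [|a u v Su Sv].
  by rewrite /defect_space /= scaler0.
have := SP a _ _ Su Sv; rewrite /defect_space /= => h.
by rewrite scalerDr scalerA mulrC -scalerA.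
Qed.

(** A maximal orthonormal subset is a basis, because a nonzero vector
orthogonal to it could be normalised and added. *)
Lemma orthonormal_basis_exists N : is_subspace N -> exists E, orthonormal_basis N E.
Proof.
move=> [N0 NP].
pose P (E : set H) := [/\ E `<=` N, forall e, E e -> inner e e = 1 &
  forall e e', E e -> E e' -> e <> e' -> inner e e' = 0].
have [F FP Ftot|E [[EN E1 E2] Emax]] := @Zorn_bigcup H P.
  split=> [e [X FX Xe]|e [X FX Xe]|e e' [X FX Xe] [Y FY Ye]].
  - by have [XN _ _] := FP _ FX; exact: XN.
  - by have [_ X1 _] := FP _ FX; exact: X1.
  - by have [XY|YX] := Ftot _ _ FX FY;
      [have [_ _ Y2] := FP _ FY; apply: Y2 => //; exact: XY
      |have [_ _ X2] := FP _ FX; apply: X2 => //; exact: YX].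
exists E; split=> // x Nx xE; apply: contrapT => /eqP x0.
(* The normalised x would enlarge E. *)
pose y := `|x|^-1 *: x.
have yE e : E e -> inner y e = 0 by move=> Ee; rewrite innerZl xE// mulr0.
have y1 : inner y y = 1.
  rewrite dnormZ inner_norm normfV normr_id -exprMn mulVf ?expr1n//.
  by rewrite normr_eq0.
apply: (Emax (y |` E)).
  split; first by move=> e Ee; right.
  move=> /(_ y (or_introl erefl)) /yE; rewrite y1 => /eqP.
  by rewrite oner_eq0.
split=> [e [->|/EN//]|e [->//|/E1//]|e e' [->|Ee] [->|Ee']//].
- by rewrite -[y]addr0; exact: NP.
- by move=> _; exact: yE.
- by move=> _; rewrite innerC yE// rmorph0.
- exact: E2.
Qed.

(** The Cayley transform of [A] maps [ran (S - conjC l)] to [ran (S - l)],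
hence the orthogonal complement of the one onto that of the other, and
orthonormal bases to orthonormal bases. *)
Lemma selfadjoint_extension_defect S A : selfadjoint A -> S `<=` A ->
  equal_defect_numbers S.
Proof.
move=> Asa SA l l0.
have lR : l \isn't Num.real.
  apply/negP => lR; move: l0.
  by rewrite (Creal_ImP _ lR) ltxx.
have lcR : conjC l \isn't Num.real by rewrite CrealE conjCK eq_sym -CrealE.
have Asym : symmetric_relation A by rewrite /symmetric_relation -Asa.
have defE f : A f -> defect_space S l (f.2 - conjC l *: f.1) <->
    defect_space S (conjC l) (f.2 - l *: f.1).
  move=> Af; split=> /defect_spaceP h; apply/defect_spaceP => g Sg.
    by rewrite conjCK (cayley_inner _ Asym)//; [exact: h|exact: SA].
  by rewrite -(cayley_inner _ Asym)//; [rewrite -{1}[l]conjCK; exact: h|exact: SA].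
have /choice[r rP] : forall y, exists f, A f /\ f.2 - conjC l *: f.1 = y.
  by move=> y; have [f ? ?] := selfadjoint_ran y Asa lcR; exists f.
pose phi y := (r y).2 - l *: (r y).1.
have phi_inner y y' : inner (phi y) (phi y') = inner y y'.
  have [Ay yE] := rP y; have [Ay' yE'] := rP y'.
  by rewrite /phi (cayley_inner _ Asym)// yE yE'.
have [E Eb] := orthonormal_basis_exists (defect_subspace S l).
have [EN E1 E2 Emax] := Eb.
exists E, (phi @` E); split=> //.
  split.
  - move=> _ [e Ee <-]; have [Ae eE] := rP e.
    by apply/(defE _ Ae); rewrite eE; exact: EN.
  - by move=> _ [e Ee <-]; rewrite phi_inner E1.
  - move=> _ _ [e Ee <-] [e' Ee' <-] ee'; rewrite phi_inner E2// => h.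
    by apply: ee'; rewrite h.
  - move=> x Nx xE; have [f Af fE] := selfadjoint_ran x Asa lR.
    apply: inner_eq0; rewrite -fE (cayley_inner _ Asym)//.
    rewrite (Emax (f.2 - conjC l *: f.1)) ?inner0l//.
      by apply/(defE _ Af); rewrite fE.
    move=> e Ee; have [Ae eE] := rP e.
    rewrite -[in X in inner _ X]eE -(cayley_inner _ Asym)// fE.
    by apply: xE; exists e.
rewrite card_eq_sym; apply: inj_card_eq => e e'; rewrite !inE => Ee Ee' phiE.
apply: contrapT => ee'; have := phi_inner e e'.
by rewrite phiE phi_inner E1// E2// => /eqP; rewrite oner_eq0.
Qed.

End Selfadjoint.

(** * Boundary relations from the conditions B1, B2 and B3 *)

Section Boundary.
Variables (R : realType) (H K : hilbertType R).
Variable G : set ((H * H) * (K * K)).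

(** Against a pair with zero boundary value the Green identity is the equation
that defines the adjoint of the domain. *)
Lemma rel_ker_adjoint_dom : green G ->
    (forall q, (forall p, G p -> green_identity p q) -> G q) ->
  rel_ker G = adjoint (rel_dom G).
Proof.
move=> Ggreen Gmax; apply/seteqP; split=> [g Gg _ [[f h] Gf <-]|g Dg] /=.
  have /= := Ggreen _ _ Gf Gg; rewrite /green_identity/= !inner0r subrr.
  by move/eqP; rewrite subr_eq0 => /eqP.
apply: Gmax => -[f h] Gf; rewrite /green_identity/= !inner0r subrr.
by rewrite Dg ?subrr//; exists (f, h).
Qed.

Hypotheses (Gsub : is_subspace G) (GB1 : B1 G) (GB2 : B2 G) (GB3 : B3 G).

Lemma green_identityB (p q r : (H * H) * (K * K)) :
  green_identity p q -> green_identity p r -> green_identity p (q - r).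
Proof.
rewrite /green_identity /= => qE rE.
by rewrite !innerBr !opprD [in LHS]addrACA [in RHS]addrACA -!opprD qE rE.
Qed.

Lemma Gamma0_surj k : exists f k', G (f, (k, k')).
Proof.
have : rel_ran (Gamma0 G) k by rewrite GB2.
by move=> [[f k0] [k' Gf] <-]; exists f, k'.
Qed.

(** Pairing with [(0, (0, k'))] leaves only [(h, k')] in the Green identity, and
the first boundary values [h] exhaust the space. *)
Lemma range_orthogonal0 k' :
  (forall p, G p -> green_identity p (0, (0, k'))) -> k' = 0.
Proof.
move=> h; apply: inner_eq0; have [f [k0 Gf]] := Gamma0_surj k'.
have := h _ Gf; rewrite /green_identity/= !inner0r !subr0 sub0r => /eqP.
by rewrite eq_sym oppr_eq0 => /eqP.
Qed.

(** The pair [q] is the sum of an element of [G] with the same first boundary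
value, an element over the kernel of [Gamma0], and a remainder [(0, (0, m))]
that the Green identity forces to vanish. *)
Lemma green_maximal q : (forall p, G p -> green_identity p q) -> G q.
Proof.
move: q => [g [k k']] q_green.
have [f0 [k0 Gf0]] := Gamma0_surj k.
pose q1 := (g, (k, k')) - (f0, (k, k0)) : (H * H) * (K * K).
have q1E : q1 = (g - f0, (0, k' - k0)) by congr (_, (_, _)); exact: subrr.
have q1_green p : G p -> green_identity p q1.
  by move=> Gp; apply: green_identityB; [exact: q_green|exact: GB1].
have [h1 /= Gh1] : rel_ker (Gamma0 G) (g - f0).
  rewrite GB3 => f [h /= Gf]; have := q1_green _ Gf.
  rewrite q1E /green_identity /= inner0l inner0r subrr => /eqP.
  by rewrite subr_eq0 => /eqP.
have m0 : k' - k0 - h1 = 0.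
  apply: range_orthogonal0 => p Gp.
  have := green_identityB (q1_green _ Gp) (GB1 Gp Gh1).
  rewrite q1E; congr green_identity.
  by congr (_, (_, _)); exact: subrr.
have := Gsub.2 1 _ _ Gh1 Gf0; congr G; rewrite scale1r; congr (_, (_, _)).
- exact: subrK.
- exact: add0r.
- by move/eqP: m0; rewrite subr_eq0 => /eqP <-; exact: subrK.
Qed.

(** The density of the domain is the statement that the double adjoint of
[rel_dom G] lies in its closure, since [rel_ker G] is the adjoint of
[rel_dom G]. *)
Lemma boundary_relation_of_B : boundary_relation (adjoint (rel_ker G)) G.
Proof.
have kerE := rel_ker_adjoint_dom GB1 green_maximal.
split=> //; last exact: green_maximal.
rewrite kerE; split; first exact: sub_biadjoint.
apply: biadjoint_sub_closure; split.
  by exists 0 => //; exact: Gsub.1.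
move=> a _ _ [u Gu <-] [v Gv <-]; exists (a *: u + v) => //; exact: Gsub.2.
Qed.

Lemma rel_ker_closed_symmetric : closed_symmetric_relation (rel_ker G).
Proof.
have kerE := rel_ker_adjoint_dom GB1 green_maximal.
split; rewrite kerE; [exact: adjoint_subspace|exact: adjoint_closed|].
move=> g Dg; apply: adjoint_anti (Dg).
by rewrite -kerE => f Gf; exists (f, 0).
Qed.

Lemma rel_ker_equal_defect : equal_defect_numbers (rel_ker G).
Proof.
by apply: selfadjoint_extension_defect GB3 _ => f Gf; exists 0.
Qed.

Lemma weyl_subspace l : is_subspace (weyl_family G l).
Proof.
split; first by exists 0; rewrite scaler0; exact: Gsub.1.
move=> a u v [f Gf] [g Gg]; exists (a *: f + g).
by rewrite scalerDr scalerA mulrC -scalerA; exact: (Gsub.2 a _ _ Gf Gg).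
Qed.

(** A defect element with zero first boundary value is an eigenvector of the
selfadjoint relation [rel_ker (Gamma0 G)] for a nonreal eigenvalue, hence
zero. *)
Lemma weyl_single_valued l k : l \isn't Num.real -> weyl_family G l (0, k) -> k = 0.
Proof.
move=> lR [f Gf]; have f0 : f = 0.
  apply: (symmetric_eigen0 (A := rel_ker (Gamma0 G)) _ lR); last by exists k.
  by rewrite /symmetric_relation -GB3.
apply: range_orthogonal0 => p Gp; have := GB1 Gp Gf.
by rewrite f0 scaler0.
Qed.

(** Start from any [f] with first boundary value [h]; correcting it by an
element [a] of [rel_ker (Gamma0 G)] with [a.2 - l *: a.1 = f.2 - l *: f.1]
keeps [h] and makes [f - a] a defect element. *)
Lemma weyl_total l h : l \isn't Num.real -> exists h', weyl_family G l (h, h').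
Proof.
move=> lR; have [f [k Gf]] := Gamma0_surj h.
have [a [k0 /= Ga] aE] := selfadjoint_ran (f.2 - l *: f.1) GB3 lR.
exists (k - k0), (f.1 - a.1); have := subspaceB Gsub Gf Ga; congr G.
congr (_, (_, _)); last exact: subr0.
congr (_, _) => /=; apply/eqP; rewrite scalerBr -subr_eq0 opprB.
rewrite [X in _ + X]addrC addrACA -[X in _ + X]opprK [- (- a.2 + _)]opprD opprK.
by rewrite aE subrr.
Qed.

Lemma weyl_functionP l h h' : l \isn't Num.real ->
  weyl_family G l (h, h') <-> h' = weyl_function G l h.
Proof.
move=> lR; have Mh : weyl_family G l (h, weyl_function G l h).
  by have /getPex := weyl_total h lR.
split=> [Mh'|->//]; apply/eqP; rewrite -subr_eq0; apply/eqP.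
apply: weyl_single_valued lR _; rewrite -(subrr h).
exact: (subspaceB (weyl_subspace l) Mh' Mh).
Qed.

Lemma weyl_family_graph l : l \isn't Num.real ->
  weyl_family G l = graph (weyl_function G l).
Proof.
move=> lR; apply/seteqP; split=> -[h h'] hh'; exact/(weyl_functionP _ _ lR).
Qed.

End Boundary.

(** * Coupling of two boundary relations *)

Section CouplingTheory.
Variables (R : realType) (H1 H2 K : hilbertType R).
Local Notation H12 := (hsum H1 H2).

Lemma selfadjoint_osum (A1 : set (H1 * H1)) (A2 : set (H2 * H2)) :
  selfadjoint A1 -> selfadjoint A2 ->
  selfadjoint [set f : H12 * H12 | exists f1 f2, [/\ f = osum f1 f2, A1 f1 & A2 f2]].
Proof.
move=> A1sa A2sa; have [A10 _] := selfadjoint_subspace A1sa.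
have [A20 _] := selfadjoint_subspace A2sa.
apply/seteqP; split=> [_ [f1 [f2 [-> Af1 Af2]]] _ [g1 [g2 [-> Ag1 Ag2]]]|].
  rewrite A1sa in Af1; rewrite A2sa in Af2.
  by rewrite !hsum_innerP/= Af1// Af2.
move=> [[x1 x2] [y1 y2]] h; exists (x1, y1), (x2, y2); split=> //.
  rewrite A1sa => f1 Af1.
  have := h (osum f1 0); rewrite !hsum_innerP /= !inner0l !addr0.
  by apply; exists f1, 0.
rewrite A2sa => f2 Af2.
have := h (osum 0 f2); rewrite !hsum_innerP /= !inner0l !add0r.
by apply; exists 0, f2.
Qed.

Variables (G1 : set ((H1 * H1) * (K * K))) (G2 : set ((H2 * H2) * (K * K))).

Lemma Gamma3_subspace : is_subspace G1 -> is_subspace G2 ->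
  is_subspace (Gamma3 G1 G2).
Proof.
move=> [G10 G1P] [G20 G2P]; split.
  by exists 0, 0, 0, 0, 0; split=> //; rewrite addr0.
move=> a u v [f1 [f2 [h [h1 [h2 [uE Gf1 Gf2]]]]]].
move=> [g1 [g2 [k [k1 [k2 [vE Gg1 Gg2]]]]]].
exists (a *: f1 + g1), (a *: f2 + g2), (a *: h + k), (a *: h1 + k1), (a *: h2 + k2).
split; [|exact: (G1P a _ _ Gf1 Gg1)|exact: (G2P a _ _ Gf2 Gg2)].
by rewrite uE vE addrACA -scalerDr.
Qed.

Lemma Gamma3_green : green G1 -> green G2 -> green (Gamma3 G1 G2).
Proof.
move=> G1g G2g p q [f1 [f2 [h [h1 [h2 [pE Gf1 Gf2]]]]]].
move=> [g1 [g2 [k [k1 [k2 [qE Gg1 Gg2]]]]]].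
have := G1g _ _ Gf1 Gg1; have := G2g _ _ Gf2 Gg2.
rewrite pE qE /green_identity /= !hsum_innerP /= => e2 e1.
by rewrite opprD addrACA e1 e2 innerDl innerDr opprD [RHS]addrACA.
Qed.

Lemma Gamma3_B2 : B2 G1 -> B2 G2 -> B2 (Gamma3 G1 G2).
Proof.
move=> G1s G2s; apply/seteqP; split=> // h _.
have [f1 [h1 Gf1]] := Gamma0_surj G1s h.
have [f2 [h2 Gf2]] := Gamma0_surj G2s h.
by exists (osum f1 f2, h) => //; exists (h1 + h2), f1, f2, h, h1, h2.
Qed.

(** The kernel of [Gamma0] for the coupling is the orthogonal sum of the two
kernels. *)
Lemma Gamma3_B3 : B3 G1 -> B3 G2 -> B3 (Gamma3 G1 G2).
Proof.
move=> G1sa G2sa; rewrite /B3.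
suff -> : rel_ker (Gamma0 (Gamma3 G1 G2)) = [set f | exists f1 f2,
    [/\ f = osum f1 f2, rel_ker (Gamma0 G1) f1 & rel_ker (Gamma0 G2) f2]].
  exact: selfadjoint_osum.
apply/seteqP; split=> [f [h' [f1 [f2 [h [h1 [h2 [[-> h0 _] Gf1 Gf2]]]]]]]|].
  by exists f1, f2; split=> //; rewrite /rel_ker /Gamma0/= h0; [exists h1|exists h2].
move=> _ [f1 [f2 [-> [h1 /= Gf1] [h2 /= Gf2]]]].
by exists (h1 + h2), f1, f2, 0, h1, h2.
Qed.

(** Zero boundary value means that the common first entry is zero and that the
second entries cancel. *)
Lemma H3_rel_ker : H3 G1 G2 = rel_ker (Gamma3 G1 G2).
Proof.
apply/seteqP; split=> [_ [f1 [f2 [h1 [-> Gf1 Gf2]]]]|].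
  by exists f1, f2, 0, h1, (- h1); split=> //; rewrite subrr.
move=> f [f1 [f2 [h [h1 [h2 [[-> <- /esym/eqP h12] Gf1 Gf2]]]]]].
move: h12; rewrite addrC addr_eq0 => /eqP h2E.
by exists f1, f2, h1; split=> //; rewrite -h2E.
Qed.

Lemma Gamma3_weyl l h h1 h2 : weyl_family G1 l (h, h1) ->
  weyl_family G2 l (h, h2) -> weyl_family (Gamma3 G1 G2) l (h, h1 + h2).
Proof.
move=> [f1 Gf1] [f2 Gf2]; exists ((f1, f2) : H12).
by exists (f1, l *: f1), (f2, l *: f2), h, h1, h2.
Qed.

End CouplingTheory.

Unset Implicit Arguments.

Theorem corollary5p5 (R : realType) (H1 H2 K : hilbertType R)
    (sepH1 : separable H1) (sepH2 : separable H2)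
    (S1 : set (H1 * H1)) (S2 : set (H2 * H2))
    (S1_cs : closed_symmetric_relation S1) (S1_op : is_operator S1)
    (S2_cs : closed_symmetric_relation S2) (S2_op : is_operator S2)
    (G1 : set ((H1 * H1) * (K * K))) (G2 : set ((H2 * H2) * (K * K)))
    (G1_bdry : boundary_relation (adjoint S1) G1)
    (G2_bdry : boundary_relation (adjoint S2) G2)
    (G1_B : [/\ B1 G1, B2 G1 & B3 G1]) (G2_B : [/\ B1 G2, B2 G2 & B3 G2]) :
  [/\ closed_symmetric_relation (H3 G1 G2) /\ equal_defect_numbers (H3 G1 G2),
      boundary_relation (adjoint (H3 G1 G2)) (Gamma3 G1 G2) /\
        [/\ B1 (Gamma3 G1 G2), B2 (Gamma3 G1 G2) & B3 (Gamma3 G1 G2)] &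
      forall l : R[i], l \isn't Num.real ->
        weyl_family (Gamma3 G1 G2) l = graph (weyl_function (Gamma3 G1 G2) l) /\
        weyl_function (Gamma3 G1 G2) l =
          (fun h => weyl_function G1 l h + weyl_function G2 l h)].
Proof.
have [G1sub _ _ _] := G1_bdry; have [G2sub _ _ _] := G2_bdry.
have [G1g G1s G1sa] := G1_B; have [G2g G2s G2sa] := G2_B.
have Gsub := Gamma3_subspace G1sub G2sub.
have Gg : B1 (Gamma3 G1 G2) := Gamma3_green G1g G2g.
have Gs := Gamma3_B2 G1s G2s; have Gsa := Gamma3_B3 G1sa G2sa.
split=> [||l lR].
- rewrite H3_rel_ker; split; first exact: rel_ker_closed_symmetric.
  exact: rel_ker_equal_defect.
- by rewrite H3_rel_ker; split=> //; exact: boundary_relation_of_B.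
- split; first exact: weyl_family_graph.
  apply: funext => h; apply/esym/(weyl_functionP Gsub Gg Gs Gsa _ _ lR).
  by apply: Gamma3_weyl; exact/weyl_functionP.
Qed.
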